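(* Let $n>0$ be an integer. The number $\delta(n+1)$ of $D$-nodes in a divide-and-conquer tree with $n+1$ leaf nodes satisfies $$\delta(n+1)=\delta(n)+\lfloor\log_2(n)\rfloor-2\,s_1(n)+2.$$
   Context: The Hamming weight $s_1(n)$ is the number of $1$s in the binary expansion of $n$. A full binary tree is a rooted binary tree in which every interior node has exactly two children. An interior node of a full binary tree is an $S$-node if its two subtrees have the same number of leaves, and a $D$-node if its two subtrees have different numbers of leaves. A divide-and-conquer tree is a full binary tree in which the numbers of leaf descendants of the left and right children of any interior node differ by at most $1$ (a child that is a leaf counts as having one leaf). For each $m\ge 1$ there is exactly one such tree with $m$ leaves up to tree isomorphism; $\delta(m)$ denotes its number of $D$-nodes. *)

(* Defs.v *)
From mathcomp Require Import all_boot zify.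

Set Implicit Arguments.
Unset Strict Implicit.
Unset Printing Implicit Defensive.

Local Open Scope nat_scope.

(* Bits at positions above floor(log2 n) vanish; [trunc_log 2 0] is 0, which
   gives weight 0 to n = 0. *)
Definition hamming_weight (n : nat) : nat :=
  \sum_(i < (trunc_log 2 n).+1) odd (n %/ 2 ^ i).

Inductive full_btree : Type :=
  | Leaf
  | Node of full_btree & full_btree.

Fixpoint leaves (t : full_btree) : nat :=
  if t is Node l r then leaves l + leaves r else 1.

Fixpoint D_nodes (t : full_btree) : nat :=
  if t is Node l r then (leaves l != leaves r) + D_nodes l + D_nodes r else 0.

Fixpoint divide_and_conquer (t : full_btree) : bool :=
  if t is Node l r then
    [&& leaves l <= (leaves r).+1, leaves r <= (leaves l).+1,
        divide_and_conquer l & divide_and_conquer r]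
  else true.

(* Isomorphism of rooted trees, where the two children are not ordered. *)
Inductive tree_iso : full_btree -> full_btree -> Prop :=
  | iso_leaf : tree_iso Leaf Leaf
  | iso_node l r l' r' :
      tree_iso l l' -> tree_iso r r' -> tree_iso (Node l r) (Node l' r')
  | iso_swap l r l' r' :
      tree_iso l r' -> tree_iso r l' -> tree_iso (Node l r) (Node l' r').

(* The first argument is a recursion bound; any value at least m will do. *)
Fixpoint dc_tree_rec (k m : nat) : full_btree :=
  if k is k'.+1 then
    if m <= 1 then Leaf
    else Node (dc_tree_rec k' (uphalf m)) (dc_tree_rec k' m./2)
  else Leaf.

(* For m >= 1, a representative of the unique isomorphism class of
   divide-and-conquer trees with m leaves; see [leaves_dc_tree],
   [divide_and_conquer_dc_tree] and [dc_tree_unique]. *)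
Definition dc_tree (m : nat) : full_btree := dc_tree_rec m m.

(* Independent of the choice of the representative, by [delta_unique].
   The value at m = 0 is meaningless. *)
Definition delta (m : nat) : nat := D_nodes (dc_tree m).

Lemma leaves_gt0 t : 0 < leaves t.
Proof. by elim: t => //= l Hl r Hr; rewrite addn_gt0 Hl. Qed.

Lemma leaves_dc_tree_rec k m : 0 < m <= k -> leaves (dc_tree_rec k m) = m.
Proof.
elim: k m => [|k IH] m /=; first by lia.
move=> Hm; case: ifP => H1 /=; first by lia.
by rewrite !IH; lia.
Qed.

Lemma leaves_dc_tree m : 0 < m -> leaves (dc_tree m) = m.
Proof. by move=> m0; rewrite leaves_dc_tree_rec ?m0 /=. Qed.

Lemma divide_and_conquer_dc_tree m : 0 < m -> divide_and_conquer (dc_tree m).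
Proof.
suff H k : 0 < m <= k -> divide_and_conquer (dc_tree_rec k m).
  by move=> m0; apply: H; rewrite m0 /=.
elim: k m => [//|k IH] m /= Hm; case: ifP => H1 //=.
by rewrite !leaves_dc_tree_rec ?IH; lia.
Qed.

Lemma dc_tree_unique t :
  divide_and_conquer t -> tree_iso t (dc_tree (leaves t)).
Proof.
suff H k : leaves t <= k -> divide_and_conquer t ->
    tree_iso t (dc_tree_rec k (leaves t)) by exact: H.
elim: t k => [|l IHl r IHr] [|k] //=.
- by move=> _ _; apply: iso_leaf.
- by have := leaves_gt0 l; lia.
move=> Hk /and4P[Hlr Hrl dl dr].
have l0 := leaves_gt0 l; have r0 := leaves_gt0 r.
rewrite ifF; last by lia.
have [H|H] := leqP (leaves r) (leaves l).
- have -> : uphalf (leaves l + leaves r) = leaves l by lia.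
  have -> : (leaves l + leaves r)./2 = leaves r by lia.
  by apply: iso_node; [apply: IHl | apply: IHr] => //; lia.
- have -> : uphalf (leaves l + leaves r) = leaves r by lia.
  have -> : (leaves l + leaves r)./2 = leaves l by lia.
  by apply: iso_swap; [apply: IHl | apply: IHr] => //; lia.
Qed.

Lemma leaves_iso t u : tree_iso t u -> leaves t = leaves u.
Proof. by elim=> //= l r l' r' _ -> _ -> //; rewrite addnC. Qed.

Lemma D_nodes_iso t u : tree_iso t u -> D_nodes t = D_nodes u.
Proof.
elim=> //= l r l' r' /leaves_iso-> -> /leaves_iso-> -> //.
by rewrite eq_sym addnAC.
Qed.

Lemma delta_unique t :
  divide_and_conquer t -> D_nodes t = delta (leaves t).
Proof. by move=> /dc_tree_unique/D_nodes_iso. Qed.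

(* Main.v *)
Require Import Defs.
From HB Require Import structures.
From mathcomp Require Import all_boot all_order all_algebra zify.

(** Every quantity in the identity obeys a recurrence on the binary expansion.
    Splitting the root of a divide-and-conquer tree with m leaves gives
    delta m = [m is odd] + delta (ceil (m/2)) + delta (floor (m/2)), so for
    k > 0 the increment f(n) = delta (n+1) - delta n satisfies
      f(2k) = f(k) + 1   and   f(2k+1) = f(k) - 1.
    Indeed delta (2k) = 2 delta k, delta (2k+1) = 1 + delta k + delta (k+1) and
    delta (2k+2) = 2 delta (k+1).
    Appending a binary digit b to k thus adds 1 - 2b to f; it also adds 1 to
    floor (log2 k) and b to the Hamming weight, so both sides of the identity
    change by the same amount. Induction on the number of binary digits,
    started at n = 1, concludes. *)

Set Implicit Arguments.
Unset Strict Implicit.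
Unset Printing Implicit Defensive.

(** Joining the two representatives of half size yields a divide-and-conquer
    tree, and all such trees with m leaves have the same number of D-nodes;
    this bypasses the recursion bound hidden in [dc_tree]. *)
Lemma delta_halves m :
  1 < m -> delta m = odd m + delta (uphalf m) + delta m./2.
Proof.
move=> m_gt1.
have up_gt0 : 0 < uphalf m by lia.
have half_gt0 : 0 < m./2 by lia.
pose t := Node (dc_tree (uphalf m)) (dc_tree m./2).
have leaves_t : leaves t = m by rewrite /= !leaves_dc_tree //; lia.
have dc_t : divide_and_conquer t.
  by rewrite /= !leaves_dc_tree // !divide_and_conquer_dc_tree // !andbT; lia.
rewrite -{1}leaves_t -(delta_unique dc_t) /= !leaves_dc_tree // /delta.
by congr (nat_of_bool _ + _ + _); lia.
Qed.

Lemma delta_double k : 0 < k -> delta k.*2 = (delta k).*2.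
Proof.
move=> k_gt0; rewrite delta_halves; last by lia.
by rewrite odd_double uphalf_double doubleK add0n addnn.
Qed.

Lemma delta_doubleS k :
  0 < k -> delta k.*2.+1 = (delta k.+1 + delta k).+1.
Proof.
move=> k_gt0; rewrite delta_halves; last by lia.
by rewrite /= odd_double uphalf_double doubleK.
Qed.

Lemma trunc_log2_append_bit (b : bool) k :
  0 < k -> trunc_log 2 (b + k.*2) = (trunc_log 2 k).+1.
Proof.
by move=> k_gt0; rewrite trunc_log2S ?half_bit_double //; lia.
Qed.

Lemma hamming_weight_append_bit (b : bool) k :
  0 < k -> hamming_weight (b + k.*2) = b + hamming_weight k.
Proof.
move=> k_gt0; rewrite /hamming_weight trunc_log2_append_bit // big_ord_recl.
rewrite expn0 divn1 oddD odd_double addbF oddb; congr (_ + _).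
apply: eq_bigr => i _.
by rewrite /= expnS divnMA divn2 half_bit_double.
Qed.

Lemma hamming_weight1 : hamming_weight 1 = 1.
Proof. by rewrite /hamming_weight trunc_log1 big_ord1. Qed.

(** Every positive integer arises from its leading binary digit 1 by appending
    digits. *)
Lemma append_bit_ind (P : nat -> Prop) :
    P 1 -> (forall (b : bool) k, 0 < k -> P k -> P (b + k.*2)) ->
  forall n, 0 < n -> P n.
Proof.
move=> P1 Pappend; elim/ltn_ind=> n IHn n_gt0.
have [n_gt1|n_le1] := ltnP 1 n; last by have -> : n = 1 by lia.
by rewrite -(odd_double_half n); apply: Pappend; [|apply: IHn]; lia.
Qed.

Local Open Scope ring_scope.

Theorem theorem21 (n : nat) (n_gt0 : (0 < n)%N) :
  (delta n.+1)%:Z =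
    (delta n)%:Z + (trunc_log 2 n)%:Z - 2 * (hamming_weight n)%:Z + 2.
Proof.
elim/append_bit_ind: n / n_gt0 => [|b k k_gt0 IHk].
  by rewrite trunc_log1 hamming_weight1.
rewrite trunc_log2_append_bit // hamming_weight_append_bit //.
case: b; rewrite ?add1n ?add0n.
  by rewrite -doubleS delta_double // delta_doubleS //; lia.
by rewrite delta_doubleS // delta_double //; lia.
Qed.
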